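(* Let $\mathbf{M}=[\underline{M},\overline{M}]$ be an $m\times n$ interval matrix. Consider the linear program in real variables $x_{k\ell}$ ($1\le k\le m$, $1\le\ell\le n$): minimize a constant subject to $x_{ij}+x_{i+1,j+1}-x_{i,j+1}-x_{i+1,j}\le 0$ for all $1\le i<m$, $1\le j<n$; $x_{k\ell}\le\overline{m}_{k\ell}$ and $-x_{k\ell}\le-\underline{m}_{k\ell}$ for all $1\le k\le m$, $1\le\ell\le n$. Then $\mathbf{M}$ has the weak Monge property if and only if this linear program has a feasible solution.
   Context: An interval matrix $\mathbf{M}=[\underline{M},\overline{M}]$ with real $m\times n$ matrices $\underline{M}\le\overline{M}$ (entrywise) is the set $\{A\in\mathbb{R}^{m\times n}:\underline{M}\le A\le\overline{M}\}$, with entries $\mathbf{m}_{ij}=[\underline{m}_{ij},\overline{m}_{ij}]$. A real matrix $A$ is Monge if $a_{ij}+a_{k\ell}\le a_{i\ell}+a_{kj}$ for all $1\le i<k\le m$, $1\le j<\ell\le n$. $\mathbf{M}$ has the weak Monge property if there exists a Monge matrix $M\in\mathbf{M}$. *)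

(* Defs.v *)
From mathcomp Require Import all_boot all_order all_algebra.
From mathcomp Require Import reals.

Set Implicit Arguments.
Unset Strict Implicit.
Unset Printing Implicit Defensive.

Import Order.TTheory GRing.Theory Num.Theory.
Local Open Scope ring_scope.

Record interval_matrix (R : realType) (m n : nat) := IntervalMatrix {
  lower : 'M[R]_(m, n);
  upper : 'M[R]_(m, n);
  lower_le_upper : forall i j, lower i j <= upper i j
}.

Definition in_interval_matrix (R : realType) (m n : nat)
    (M : interval_matrix R m n) (A : 'M[R]_(m, n)) : Prop :=
  forall i j, lower M i j <= A i j <= upper M i j.

Definition monge (R : realType) (m n : nat) (A : 'M[R]_(m, n)) : Prop :=
  forall (i k : 'I_m) (j l : 'I_n), (i < k)%N -> (j < l)%N ->
    A i j + A k l <= A i l + A k j.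

Definition weak_monge (R : realType) (m n : nat)
    (M : interval_matrix R m n) : Prop :=
  exists2 A : 'M[R]_(m, n), in_interval_matrix M A & monge A.

(* A linear program whose variables x_kl form an m x n matrix:
     minimize  <lp_cost, x> + lp_offset
     subject to  <lp_coef c, x> <= lp_rhs c  for every constraint c,
   where <a, x> is the entrywise product sum lin_form a x. *)
Record linear_program (R : realType) (m n : nat) := LinearProgram {
  lp_cost : 'M[R]_(m, n);
  lp_offset : R;
  lp_constraint : finType;
  lp_coef : lp_constraint -> 'M[R]_(m, n);
  lp_rhs : lp_constraint -> R
}.

Definition lin_form (R : realType) (m n : nat) (a x : 'M[R]_(m, n)) : R :=
  \sum_k \sum_l a k l * x k l.

Definition lp_feasible (R : realType) (m n : nat)
    (P : linear_program R m n) (x : 'M[R]_(m, n)) : Prop :=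
  forall c : lp_constraint P, lin_form (lp_coef c) x <= lp_rhs c.

Definition nonlast (m : nat) : Type := {i : 'I_m | (i.+1 < m)%N}.

Definition idx (m : nat) (i : nonlast m) : 'I_m := val i.

Definition idx_succ (m : nat) (i : nonlast m) : 'I_m := Ordinal (valP i).

Definition monge_constraint (m n : nat) : Type :=
  ((nonlast m * nonlast n) + (('I_m * 'I_n) + ('I_m * 'I_n)))%type.

(* delta_mx k l is the coefficient matrix of the single variable x_kl; the
   three summands are the adjacent 2 x 2 inequalities, the upper bounds and the
   (negated) lower bounds. *)
Definition monge_coef (R : realType) (m n : nat)
    (c : monge_constraint m n) : 'M[R]_(m, n) :=
  match c with
  | inl (i, j) =>
      delta_mx (idx i) (idx j) + delta_mx (idx_succ i) (idx_succ j)
      - delta_mx (idx i) (idx_succ j) - delta_mx (idx_succ i) (idx j)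
  | inr (inl (k, l)) => delta_mx k l
  | inr (inr (k, l)) => - delta_mx k l
  end.

Definition monge_rhs (R : realType) (m n : nat) (M : interval_matrix R m n)
    (c : monge_constraint m n) : R :=
  match c with
  | inl _ => 0
  | inr (inl (k, l)) => upper M k l
  | inr (inr (k, l)) => - lower M k l
  end.

(* The objective is the constant function z. *)
Definition monge_lp (R : realType) (m n : nat) (M : interval_matrix R m n)
    (z : R) : linear_program R m n :=
  @LinearProgram R m n 0 z (monge_constraint m n) (@monge_coef R m n)
    (monge_rhs M).

(* Main.v *)
Require Import Defs.
From mathcomp Require Import all_boot all_order all_algebra.
From mathcomp Require Import reals.
From mathcomp Require Import lra.

(** Adjacent inequalities telescope: for adjacent columns j, j+1 the difference
    A i j - A i (j+1) is nondecreasing from each row to the next, hence in i;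
    so for any rows i < k the difference A i j - A k j is nondecreasing from
    each column to the next, hence in j. *)

Import Order.TTheory GRing.Theory Num.Theory.
Local Open Scope ring_scope.

Lemma lin_formD (R : realType) (m n : nat) (a b x : 'M[R]_(m, n)) :
  lin_form (a + b) x = lin_form a x + lin_form b x.
Proof.
rewrite /lin_form -big_split; apply: eq_bigr => k _ /=.
by rewrite -big_split; apply: eq_bigr => l _; rewrite mxE mulrDl.
Qed.

Lemma lin_formN (R : realType) (m n : nat) (a x : 'M[R]_(m, n)) :
  lin_form (- a) x = - lin_form a x.
Proof.
rewrite /lin_form -sumrN; apply: eq_bigr => k _.
by rewrite -sumrN; apply: eq_bigr => l _; rewrite mxE mulNr.
Qed.

(** Together with [lin_formD] and [lin_formN] this evaluates every constraint of [monge_lp], as each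
    [monge_coef] is a signed sum of matrices [delta_mx]. *)
Lemma lin_form_delta (R : realType) (m n : nat) (i : 'I_m) (j : 'I_n)
    (x : 'M[R]_(m, n)) : lin_form (delta_mx i j) x = x i j.
Proof.
rewrite /lin_form (bigD1 i) //= (bigD1 j) //= mxE !eqxx mul1r.
rewrite big1 => [|l /negPf lj]; last by rewrite mxE lj andbF mul0r.
rewrite big1 => [|k /negPf ki]; first by rewrite !addr0.
by apply: big1 => l _; rewrite mxE ki mul0r.
Qed.

(** Induction on the value of [k], whose predecessors all stay below [m]. Relating two ordinals by
    [i.+1 = k] avoids building a successor in ['I_m]. *)
Lemma ord_homo_leq (R : realType) (m : nat) (f : 'I_m -> R) :
  (forall i k : 'I_m, i.+1 = k -> f i <= f k) ->
  forall i k : 'I_m, (i <= k)%N -> f i <= f k.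
Proof.
move=> f_step i [k lt_km] /=; elim: k => [|k IHk] in lt_km *.
  by rewrite leqn0 => /eqP i0; rewrite (_ : i = Ordinal lt_km) //; apply: val_inj.
rewrite leq_eqVlt => /predU1P[i_eq|lt_ik].
  by rewrite (_ : i = Ordinal lt_km) //; apply: val_inj.
by apply: le_trans (IHk (ltnW lt_km) lt_ik) _; apply: f_step.
Qed.

Lemma adjacent_monge (R : realType) (m n : nat) (A : 'M[R]_(m, n)) :
  (forall (i k : 'I_m) (j l : 'I_n), i.+1 = k -> j.+1 = l ->
     A i j + A k l <= A i l + A k j) ->
  monge A.
Proof.
move=> A_adj i k j l /ltnW le_ik /ltnW le_jl.
have row_mono (p q : 'I_n) : p.+1 = q -> A i p - A i q <= A k p - A k q.
  move=> pq; apply: (@ord_homo_leq _ _ (fun r => A r p - A r q)) le_ik => r s rs.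
  by have := A_adj r s p q rs pq; lra.
have : A i j - A k j <= A i l - A k l.
  apply: (@ord_homo_leq _ _ (fun p => A i p - A k p)) le_jl => p q pq.
  by have := row_mono p q pq; lra.
lra.
Qed.

Theorem theorem4p1 (R : realType) (m n : nat) (M : interval_matrix R m n)
    (z : R) :
  weak_monge M <-> exists x : 'M[R]_(m, n), lp_feasible (monge_lp M z) x.
Proof.
split=> [[A A_in A_monge]|[A A_feas]]; exists A.
- case=> [[i j]|[[k l]|[k l]]] /=;
    rewrite ?lin_formD ?lin_formN ?lin_form_delta.
  (* The first kind of constraint is the Monge inequality for two consecutive rows and columns, with
     all terms on the left. *)
  + have := A_monge (idx i) (idx_succ i) (idx j) (idx_succ j)
      (ltnSn _) (ltnSn _); lra.
  + by case/andP: (A_in k l).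
  + by rewrite lerN2; case/andP: (A_in k l).
- move=> k l; have := A_feas (inr (inl (k, l))); have := A_feas (inr (inr (k, l))).
  by rewrite /= lin_formN lin_form_delta lerN2 => -> ->.
- apply: adjacent_monge => i k j l ik jl.
  (* Having successors [k] and [l], the indices [i] and [j] are not last, so the program has a
     constraint at this pair. *)
  have lt_im : (i.+1 < m)%N by rewrite ik.
  have lt_jn : (j.+1 < n)%N by rewrite jl.
  have := A_feas (inl (Sub i lt_im, Sub j lt_jn)).
  rewrite /= !lin_formD !lin_formN !lin_form_delta.
  (* The two ordinals carry different bound proofs but the same value, by [ik]. *)
  have -> : idx_succ (Sub i lt_im) = k by apply: val_inj.
  have -> : idx_succ (Sub j lt_jn) = l by apply: val_inj.
  rewrite /idx !SubK; lra.
Qed.
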